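(* Let $q,t\ge 0$ and $k\ge 1$ be integers and let $A$ be an $m\times n$ complex matrix which is a $(q,k,t)$-design matrix. Then $$\mathrm{rank}(A)\;\ge\; n-\left(\frac{q\cdot t\cdot n}{2k}\right)^2 .$$
   Context: For an $m\times n$ matrix $A$, let $R_i\subseteq[n]$ be the set of column indices of the non-zero entries of row $i$, and $C_j\subseteq[m]$ the set of row indices of the non-zero entries of column $j$. $A$ is a $(q,k,t)$-design matrix if (1) $|R_i|\le q$ for all $i\in[m]$; (2) $|C_j|\ge k$ for all $j\in[n]$; (3) $|C_{j_1}\cap C_{j_2}|\le t$ for all $j_1\ne j_2\in[n]$. *)

(* Defs.v *)
From HB Require Import structures.
From mathcomp Require Import all_boot all_order all_algebra.
From mathcomp Require Import reals.
From mathcomp.real_closed Require Import complex.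

Set Implicit Arguments.
Unset Strict Implicit.
Unset Printing Implicit Defensive.

Import Order.TTheory GRing.Theory Num.Theory.
Local Open Scope ring_scope.

Definition row_supp (V : nmodType) (m n : nat) (A : 'M[V]_(m, n))
    (i : 'I_m) : {set 'I_n} :=
  [set j | A i j != 0].

Definition col_supp (V : nmodType) (m n : nat) (A : 'M[V]_(m, n))
    (j : 'I_n) : {set 'I_m} :=
  [set i | A i j != 0].

Definition design_matrix (V : nmodType) (q k t m n : nat)
    (A : 'M[V]_(m, n)) : Prop :=
  [/\ forall i : 'I_m, (#|row_supp A i| <= q)%N,
      forall j : 'I_n, (k <= #|col_supp A j|)%N
    & forall j1 j2 : 'I_n, j1 != j2 ->
        (#|col_supp A j1 :&: col_supp A j2| <= t)%N].

(* Main.v *)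
(** Rescaling the rows and columns of [A] by positive reals changes neither its
    rank nor its supports.  Put on the entry [(i, j)] the share of
    [|A i j|^2 z_j] in the [i]-th row sum [sum_j |A i j|^2 z_j].  The product
    of these shares over the support of [A] is at most [1], and if the shares
    of some column [j], with row [i] counted [|R_i|] times, sum to at most
    [|C_j| - e], then inflating [z_j] multiplies the product by a factor
    bounded away from [1].  Hence after finitely many inflations every column
    sum exceeds [|C_j| - e >= k - e].  For this scaling, the Gram matrix of the
    columns with row weights [|R_i|], divided by its diagonal, is the identity
    plus off-diagonal entries of modulus at most [qt / (2 (k - e))].  A matrix
    [1 + E] has corank at most [||E||_F^2], since [E] acts as [-1] on the kernel
    of [1 + E]; finally [e] tends to [0]. *)
Require Import Defs.
From HB Require Import structures.
From mathcomp Require Import all_boot all_order all_algebra.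
From mathcomp Require Import reals.
From mathcomp.real_closed Require Import complex.
From mathcomp Require Import ring lra.

Set Implicit Arguments.
Unset Strict Implicit.
Unset Printing Implicit Defensive.

Import Order.TTheory GRing.Theory Num.Theory.
Local Open Scope ring_scope.

(** * Elementary product inequalities *)

Lemma bernoulli_le (R : realDomainType) (x : R) (n : nat) :
  0 <= x -> 1 + n%:R * x <= (1 + x) ^+ n.
Proof.
move=> x0; elim: n => [|n IHn]; first by rewrite mul0r addr0 expr0.
rewrite exprS -natr1.
have h : 0 <= n%:R * x * x by rewrite !mulr_ge0.
apply: le_trans (ler_wpM2l _ IHn); first by nra.
by rewrite addr_ge0.
Qed.

Lemma weierstrass_prod_ge (R : realDomainType) (I : Type) (r : seq I)
    (P : pred I) (F : I -> R) :
  (forall i, P i -> 0 <= F i <= 1) ->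
  1 - \sum_(i <- r | P i) F i <= \prod_(i <- r | P i) (1 - F i).
Proof.
move=> F01.
(* The bound by 1 is carried along: a new factor lowers the product [p] by [F i * p], which is at
   most [F i] because [p <= 1]. *)
suff: 1 - \sum_(i <- r | P i) F i <= \prod_(i <- r | P i) (1 - F i) <= 1.
  by case/andP.
elim/big_rec2: _ => [|i p s Pi /andP[sp p1]]; first by rewrite subr0 lexx.
have /andP[F0 F1] := F01 i Pi.
by apply/andP; split; nra.
Qed.

(** * Approximate matrix scaling by a potential argument *)

(* The multipliers [z] scale the columns; [share z i j] is the normalised
   weight of the entry [(i, j)], and is [0] on a zero row since [x / 0 = 0]. *)
Section Scaling.
Variables (R : archiRealFieldType) (m n : nat) (B : 'M[R]_(m, n)).
Hypothesis B_ge0 : forall i j, 0 <= B i j.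

Definition row_weight (z : 'I_n -> R) (i : 'I_m) : R := \sum_j B i j * z j.

Definition share (z : 'I_n -> R) (i : 'I_m) (j : 'I_n) : R :=
  B i j * z j / row_weight z i.

Section Share.
Variable z : 'I_n -> R.
Hypothesis z_gt0 : forall j, 0 < z j.

Lemma weight_ge0 i j : 0 <= B i j * z j.
Proof. by rewrite mulr_ge0 // ltW. Qed.

Lemma row_weight_ge0 i : 0 <= row_weight z i.
Proof. by apply: sumr_ge0 => j _; apply: weight_ge0. Qed.

Lemma weight_le i j : B i j * z j <= row_weight z i.
Proof.
rewrite /row_weight (bigD1 j) //= lerDl sumr_ge0 // => k _.
exact: weight_ge0.
Qed.

Lemma share_ge0 i j : 0 <= share z i j.
Proof. by rewrite divr_ge0 ?weight_ge0 ?row_weight_ge0. Qed.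

Lemma share_gt0 i j : B i j != 0 -> 0 < share z i j.
Proof.
move=> Bij; have h : 0 < B i j * z j by rewrite mulr_gt0 // lt0r Bij B_ge0.
by rewrite divr_gt0 // (lt_le_trans h) // weight_le.
Qed.

Lemma sum_share_le1 i : \sum_j share z i j <= 1.
Proof.
rewrite -mulr_suml -/(row_weight z i).
by have [->|w0] := eqVneq (row_weight z i) 0; rewrite ?mul0r ?ler01 ?divff.
Qed.

Lemma share_le1 i j : share z i j <= 1.
Proof.
apply: le_trans (sum_share_le1 i).
by rewrite (bigD1 j) //= lerDl sumr_ge0 // => k _; apply: share_ge0.
Qed.

Lemma shareD_le1 i j l : j != l -> share z i j + share z i l <= 1.
Proof.
move=> jl; apply: le_trans (sum_share_le1 i).
rewrite (bigD1 j) //= (bigD1 l) /= 1?eq_sym // addrA lerDl.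
by rewrite sumr_ge0 // => k _; apply: share_ge0.
Qed.

(** A zero row weight forces its nonnegative terms to vanish, so division by 0 does no harm. *)
Lemma shareK i j : share z i j * row_weight z i = B i j * z j.
Proof.
have [w0|w0] := eqVneq (row_weight z i) 0; last by rewrite divfK.
by apply/eqP; rewrite w0 mulr0 eq_le weight_ge0 -w0 weight_le.
Qed.

End Share.

Definition inflate (z : 'I_n -> R) (u : R) (l j : 'I_n) : R :=
  (if j == l then 1 + u else 1) * z j.

Lemma inflate_gt0 z u l : (forall j, 0 < z j) -> 0 <= u ->
  forall j, 0 < inflate z u l j.
Proof.
by move=> z0 u0 j; rewrite mulr_gt0 //; case: ifP => // _; rewrite ltr_wpDr.
Qed.

Lemma row_weight_inflate z u l i : (forall j, 0 < z j) ->
  row_weight (inflate z u l) i = row_weight z i * (1 + u * share z i l).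
Proof.
move=> z0; rewrite mulrDr mulr1 [_ * (u * _)]mulrC -mulrA shareK //.
rewrite /row_weight (bigD1 l) //= [in RHS](bigD1 l) //= /inflate eqxx.
under eq_bigr => j /negPf -> do rewrite mul1r.
by ring.
Qed.

Lemma share_inflate z u l i j : (forall j, 0 < z j) ->
  share (inflate z u l) i j =
  share z i j * ((if j == l then 1 + u else 1) / (1 + u * share z i l)).
Proof.
move=> z0; rewrite /share row_weight_inflate // /inflate invfM -/(share z i l).
by rewrite [_ * z j]mulrC !mulrA; congr (_ * _); rewrite mulrAC.
Qed.

Definition potential (z : 'I_n -> R) : R :=
  \prod_j \prod_(i in col_supp B j) share z i j.

(** The factor counts the entries of row [i] in [potential]: inflating column [j] divides each of
    them by [1 + u * share z i j]. *)
Definition col_mass (z : 'I_n -> R) (j : 'I_n) : R :=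
  \sum_i #|row_supp B i|%:R * share z i j.

Lemma potential_gt0 z : (forall j, 0 < z j) -> 0 < potential z.
Proof.
move=> z0; apply: prodr_gt0 => j _; apply: prodr_gt0 => i.
by rewrite inE => Bij; apply: share_gt0.
Qed.

Lemma potential_le1 z : (forall j, 0 < z j) -> potential z <= 1.
Proof.
move=> z0; apply: prodr_ile1 => j _.
have s01 i : 0 <= share z i j <= 1 by rewrite share_ge0 ?share_le1.
by rewrite prodr_ge0 ?prodr_ile1 // => i _; case/andP: (s01 i).
Qed.

Lemma col_massE z l :
  col_mass z l = \sum_j \sum_(i in col_supp B j) share z i l.
Proof.
rewrite (exchange_big_dep predT) //=; apply: eq_bigr => i _.
rewrite (eq_bigl (mem (row_supp B i))) => [|j]; last by rewrite !inE.
by rewrite sumr_const mulr_natl.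
Qed.

(** The support entries of column [l] contribute the power of [1 + u]. The denominators
    [1 + u * share z i l], one per support entry of the matrix, are handled by
    [1 / (1 + x) >= 1 - x] and the Weierstrass inequality. *)
Lemma potential_inflate z u l : (forall j, 0 < z j) -> 0 <= u <= 1 ->
  potential z * ((1 + u) ^+ #|col_supp B l| * (1 - u * col_mass z l))
    <= potential (inflate z u l).
Proof.
move=> z0 /andP[u0 u1].
have us01 i : 0 <= u * share z i l <= 1.
  by rewrite mulr_ge0 ?share_ge0 // mulr_ile1 ?share_ge0 ?share_le1.
have -> : potential (inflate z u l) = potential z *
    (\prod_j \prod_(i in col_supp B j) (if j == l then 1 + u else 1) *
     \prod_j \prod_(i in col_supp B j) (1 + u * share z i l)^-1).
  rewrite /potential -!big_split; apply: eq_bigr => j _ /=.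
  by rewrite -!big_split; apply: eq_bigr => i _; rewrite share_inflate.
apply: ler_wpM2l; first exact: ltW (potential_gt0 _).
have -> : \prod_j \prod_(i in col_supp B j) (if j == l then 1 + u else 1) =
          (1 + u) ^+ #|col_supp B l|.
  rewrite (bigD1 l) //= eqxx prodr_const big1 ?mulr1 // => j /negPf ->.
  by rewrite big1_eq.
apply: ler_wpM2l; first by rewrite exprn_ge0 ?addr_ge0.
rewrite col_massE mulr_sumr.
under [X in 1 - X]eq_bigr do rewrite mulr_sumr.
rewrite !pair_big_dep /=.
apply: le_trans (weierstrass_prod_ge _ (fun p _ => us01 p.2)) _.
apply: ler_prod => -[j i] _ /=; have /andP[s0 s1] := us01 i.
rewrite subr_ge0 s1 /= -[leRHS]mul1r ler_pdivlMr; first by nra.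
by rewrite ltr_wpDr.
Qed.

Lemma approx_scaling (e : R) : 0 < e ->
  exists2 z : 'I_n -> R, (forall j, 0 < z j)
    & forall j, #|col_supp B j|%:R - e < col_mass z j.
Proof.
(* Lowering [e] strengthens the claim; [e <= 1] yields the bound [u <= 1] that [potential_inflate]
   demands. *)
wlog e1 : e / e <= 1 => [IH e0|e0].
  have [||z z0 zP] := IH (Num.min e 1); rewrite ?ge_min ?lexx ?orbT //.
    by rewrite lt_min e0 ltr01.
  exists z => // j; apply: le_lt_trans (zP j).
  by rewrite lerB // ge_min lexx.
(* With column size [c] and mass [g <= c - e], Bernoulli gives a factor of at least [(1 + c u)(1 - u
   g) = 1 + u (c - g) - u^2 c g]. The gain is at least [u e], and [u] makes the loss at most
   [u^2 M^2 = u e / 2], leaving [1 + d]. *)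
pose M : R := m.+1%:R; pose u := e / (2 * M ^+ 2); pose d := u * e / 2.
have M1 : 1 <= M by rewrite ler1n.
have uM : u * (2 * M ^+ 2) = e by rewrite divfK // mulf_neq0 ?expf_neq0; lra.
have u0 : 0 < u by rewrite divr_gt0 // mulr_gt0 // exprn_gt0; lra.
have M2 : 1 <= M ^+ 2 by rewrite expr_ge1 ?M1 // ler0n.
have u1 : u <= 1 by nra.
have d0 : 0 < d by rewrite divr_gt0 // mulr_gt0.
have step z : (forall j, 0 < z j) ->
    (forall j, #|col_supp B j|%:R - e < col_mass z j) \/
    exists2 z', (forall j, 0 < z' j) & (1 + d) * potential z <= potential z'.
  move=> z0.
  have [/forallP h|] := boolP [forall j, #|col_supp B j|%:R - e < col_mass z j].
    by left.
  rewrite negb_forall => /existsP[l]; rewrite -leNgt => gl; right.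
  exists (inflate z u l); first by apply: inflate_gt0 => //; apply: ltW.
  apply: le_trans (potential_inflate l z0 _); last by rewrite ltW.
  rewrite mulrC; apply: ler_wpM2l; first exact: ltW (potential_gt0 _).
  have c0 : 0 <= #|col_supp B l|%:R :> R by [].
  have cM : #|col_supp B l|%:R <= M :> R.
    by rewrite ler_nat (leq_trans (max_card _)) // card_ord.
  have g0 : 0 <= col_mass z l.
    by apply: sumr_ge0 => i _; rewrite mulr_ge0 ?share_ge0.
  have := bernoulli_le #|col_supp B l| (ltW u0).
  move: gl c0 cM g0; move: (col_mass z l) => g; move: (_%:R) => c.
  move=> gl c0 cM g0 cu.
  have ug : 0 <= 1 - u * g by nra.
  apply: le_trans (ler_wpM2r ug cu).
  have : c * g <= M ^+ 2 by nra.
  rewrite /d; nra.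
have iter N : (exists2 z, (forall j, 0 < z j) &
      forall j, #|col_supp B j|%:R - e < col_mass z j) \/
    exists2 z, (forall j, 0 < z j) &
      (1 + d) ^+ N * potential (fun=> 1) <= potential z.
  elim: N => [|N [|[z z0 zP]]]; [|by left|].
    by right; exists (fun=> 1) => //; rewrite mul1r.
  have [|[z' z'0 z'P]] := step z z0; first by left; exists z.
  right; exists z' => //; apply: le_trans z'P.
  by rewrite exprS -mulrA ler_wpM2l // ltW // ltr_wpDr // ltW.
have p0 : 0 < potential (fun=> 1) by apply: potential_gt0.
move: (potential _) p0 iter => p p0 iter.
have dp0 : 0 < d * p by rewrite mulr_gt0.
(* For [N > 1 / (d p)], Bernoulli gives [(1 + d)^N p > 1], against [potential_le1]. *)
have [//|[z z0 zP]] := iter (Num.bound (d * p)^-1).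
have := archi_boundP (ltW (_ : 0 < (d * p)^-1)); rewrite invr_gt0 => /(_ dp0).
move: zP; set N := Num.bound _ => zP; rewrite -(ltr_pM2r dp0).
rewrite mulVf ?gt_eqF // => hN.
have hp := le_trans zP (potential_le1 z0).
have := ler_wpM2r (ltW p0) (bernoulli_le N (ltW d0)).
by nra.
Qed.

End Scaling.

(** * Rank of a matrix close to the identity *)

Section RankBound.
Local Open Scope sesquilinear_scope.
Variable C : numClosedFieldType.

Lemma mxtrace_mulmxtC m n (M : 'M[C]_(m, n)) :
  \tr (M *m M^t*) = \sum_i \sum_j `|M i j| ^+ 2.
Proof.
apply: eq_bigr => i _; rewrite mxE; apply: eq_bigr => j _.
by rewrite !mxE normCK.
Qed.

Lemma trmxC_mul m n p (M : 'M[C]_(m, n)) (N : 'M[C]_(n, p)) :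
  (M *m N)^t* = N^t* *m M^t*.
Proof. by rewrite trmx_mul map_mxM. Qed.

(** Pythagoras for the Frobenius norm: [Q] has orthonormal rows, and [E] is the sum of its
    projection [Q^t* Q E] and a remainder [D] with [Q D = 0], so the cross terms have trace 0. *)
Lemma unitary_mul_le m n p (Q : 'M[C]_(m, n)) (E : 'M[C]_(n, p)) :
  Q \is unitarymx -> \tr ((Q *m E) *m (Q *m E)^t*) <= \tr (E *m E^t*).
Proof.
move=> /unitarymxP QQ; pose D := E - Q^t* *m (Q *m E).
have QD : Q *m D = 0.
  by rewrite mulmxBr [Q *m (Q^t* *m _)]mulmxA QQ mul1mx subrr.
have DQ : D^t* *m Q^t* = 0 by rewrite -trmxC_mul QD trmx0 map_mx0.
have -> : \tr (E *m E^t*) = \tr ((Q *m E) *m (Q *m E)^t*) + \tr (D *m D^t*).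
  have -> : E *m E^t* = (D + Q^t* *m (Q *m E)) *m (D + Q^t* *m (Q *m E))^t*.
    by rewrite subrK.
  move: D (Q *m E) QD DQ => {}D F QD DQ.
  rewrite linearD /= map_mxD trmxC_mul trmxCK mulmxDl !mulmxDr !raddfD /=.
  rewrite [\tr (D *m (_ *m Q))]mxtrace_mulC -[F^t* *m Q *m D]mulmxA QD mulmx0.
  rewrite [\tr (_ *m F *m D^t*)]mxtrace_mulC [D^t* *m _]mulmxA DQ mul0mx.
  rewrite [\tr (_ *m F *m (_ *m Q))]mxtrace_mulC -mulmxA.
  rewrite [Q *m _]mulmxA QQ mul1mx.
  by rewrite [\tr (F^t* *m F)]mxtrace_mulC mxtrace0 addr0 add0r addrC.
rewrite lerDl mxtrace_mulmxtC.
by apply: sumr_ge0 => i _; apply: sumr_ge0 => j _; rewrite exprn_ge0.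
Qed.

(** Let the rows of [Q] be an orthonormal basis of the left kernel of [N]. Then [Q (N - 1) = - Q]
    has squared Frobenius norm [n - rank N]. *)
Lemma mxrank_near_id n (N : 'M[C]_n) :
  n%:R - \sum_i \sum_j `|(N - 1%:M) i j| ^+ 2 <= (\rank N)%:R.
Proof.
pose Q := schmidt (row_base (kermx N)).
have Qu : Q \is unitarymx by rewrite schmidt_unitarymx // rank_leq_col.
have QN : Q *m N = 0.
  by apply/sub_kermxP; rewrite eqmx_schmidt_free ?row_base_free ?eq_row_base.
have := unitary_mul_le (N - 1%:M) Qu.
rewrite mulmxBr QN sub0r mulmx1 -mxtrace_mulmxtC.
have -> : (- Q) *m (- Q)^t* = 1%:M.
  by rewrite linearN /= map_mxN mulNmx mulmxN opprK (unitarymxP Qu).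
rewrite mxtrace1 mxrank_ker natrB ?rank_leq_row //.
by rewrite lerBlDl -lerBlDr => /le_trans; apply; rewrite // lerBlDl.
Qed.

End RankBound.

(** * The rank bound for design matrices *)

Lemma amgm_div (R : rcfType) (a b s : R) :
  0 <= s -> a ^+ 2 / s + b ^+ 2 / s <= 1 -> a * b / s <= 2^-1.
Proof.
move=> s0; have is0 : 0 <= s^-1 by rewrite invr_ge0.
have : 0 <= (a - b) ^+ 2 * s^-1 by rewrite mulr_ge0 ?sqr_ge0.
nra.
Qed.

Lemma design_rank_approx (R : archiRcfType) (q k t m n : nat)
    (A : 'M[complex R]_(m, n)) (e : R) :
  design_matrix q k t A -> 0 < e -> e < k%:R ->
  n%:R - (q%:R * t%:R * n%:R / (2 * (k%:R - e))) ^+ 2 <= (\rank A)%:R :> R.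
Proof.
move=> [rowA colA capA] e0 ek.
pose a i j : R := Normc.normc (A i j).
have a_ge0 i j : 0 <= a i j by rewrite -ler0c; apply: (normr_ge0 (A i j)).
have a_eq0 i j : (a i j == 0) = (A i j == 0).
  by rewrite -(inj_eq (@complexI R)) -[LHS]/(`|A i j| == 0) normr_eq0.
pose B : 'M[R]_(m, n) := \matrix_(i, j) a i j ^+ 2.
have B_ge0 i j : 0 <= B i j by rewrite mxE sqr_ge0.
have BA i j : (B i j != 0) = (A i j != 0) by rewrite mxE sqrf_eq0 a_eq0.
have rowB i : row_supp B i = row_supp A i by apply/setP => j; rewrite !inE BA.
have colB j : col_supp B j = col_supp A j by apply/setP => i; rewrite !inE BA.
have [z z0 zP] := approx_scaling B_ge0 e0.
(* [B] holds squared moduli, so scaling its columns by [z] means scaling those of [A] by the square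
   root [w]. *)
pose s := row_weight B z; pose g := col_mass B z; pose w j := Num.sqrt (z j).
have s0 i : 0 <= s i by apply: row_weight_ge0.
have ke0 : 0 < k%:R - e by lra.
have gk j : k%:R - e <= g j.
  apply/ltW/(le_lt_trans _ (zP j)); rewrite colB.
  by rewrite lerB ?ler_nat.
have g0 j : 0 < g j by apply: lt_le_trans (gk j).
have w2 j : w j ^+ 2 = z j by rewrite sqr_sqrtr ?ltW.
have w0 j : 0 <= w j by apply: sqrtr_ge0.
pose r i : R := #|row_supp B i|%:R.
have r0 i : 0 <= r i by [].
have rq i : r i <= q%:R by rewrite ler_nat rowB.
(* [N] below is the Gram matrix of the columns scaled by [w], with row weights [r i / s i], each row
   divided by its diagonal entry [g j]. The factorisation through [A] bounds its rank by that of
   [A]. *)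
pose P : 'M[complex R]_(n, m) :=
  \matrix_(j, i) (real_complex R (r i * w j / (s i * g j)) * (A i j)^*).
pose N := P *m A *m diag_mx (\row_j real_complex R (w j)).
have NE j l : N j l = \sum_i real_complex R (r i * w j * w l / (s i * g j)) *
    ((A i j)^* * A i l).
  rewrite /N mul_mx_diag !mxE mulr_suml; apply: eq_bigr => i _.
  by rewrite !mxE !rmorphM /=; ring.
have shareE i j : share B z i j = (w j * a i j) ^+ 2 / s i.
  by rewrite /share mxE exprMn w2 [z j * _]mulrC.
have Njj j : N j j = 1.
  rewrite NE -(rmorph1 (real_complex R)) -(divff (lt0r_neq0 (g0 j))).
  rewrite {2}/g /col_mass mulr_suml rmorph_sum; apply: eq_bigr => i _.
  rewrite -normCKC -[`|A i j|]/(real_complex R (a i j)) -rmorphXn -rmorphM.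
  by congr (real_complex R _); rewrite shareE exprMn invfM -/(r i); ring.
have Njl j l : j != l ->
    `|N j l| <= real_complex R (q%:R * t%:R / (2 * (k%:R - e))).
  move=> jl; rewrite NE; apply: le_trans (ler_norm_sum _ _ _) _.
  (* The modulus of the [i]-th summand, split so that the first factor is at most [q / (k - e)] and
     AM-GM bounds the second by 1/2. At most [t] rows, those meeting both columns, contribute. *)
  pose F i := r i / g j * (w j * a i j * (w l * a i l) / s i).
  have rg0 i : 0 <= r i / g j by rewrite divr_ge0 // ltW.
  have F0 i : 0 <= F i.
    by rewrite mulr_ge0 // divr_ge0 // !mulr_ge0.
  under eq_bigr => i _.
    rewrite 2!normrM norm_conjC.
    rewrite ger0_norm ?ler0c; last by rewrite divr_ge0 ?mulr_ge0 // ltW.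
    rewrite -[`|A i j|]/(real_complex R (a i j)).
    rewrite -[`|A i l|]/(real_complex R (a i l)) -!rmorphM.
    have -> : r i * w j * w l / (s i * g j) * (a i j * a i l) = F i.
      by rewrite /F invfM; ring.
    over.
  rewrite -rmorph_sum lecR.
  rewrite (bigID [in col_supp A j :&: col_supp A l]) /=.
  rewrite [X in _ + X]big1 ?addr0 => [|i]; last first.
    rewrite !inE negb_and !negbK /F -!a_eq0.
    by case/orP => /eqP ->; rewrite !(mulr0, mul0r).
  have Fle i : F i <= q%:R / (k%:R - e) * 2^-1.
    apply: ler_pM => //.
    - by rewrite divr_ge0 // !mulr_ge0.
    - apply: ler_pM => //; first by rewrite invr_ge0 ltW.
      by rewrite lef_pV2 ?posrE.
    by apply: amgm_div => //; rewrite -!shareE; apply: shareD_le1.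
  apply: le_trans (ler_sum _ (fun i _ => Fle i)) _.
  rewrite sumr_const -[_ *+ #|_|]mulr_natl.
  have tA : #|col_supp A j :&: col_supp A l|%:R <= t%:R :> R.
    by rewrite ler_nat capA.
  have qk : 0 <= q%:R / (k%:R - e) * 2^-1 :> R.
    by rewrite !mulr_ge0 // invr_ge0 ltW.
  rewrite [leRHS](_ : _ = t%:R * (q%:R / (k%:R - e) * 2^-1)).
    exact: ler_wpM2r.
  by rewrite invfM; ring.
have := mxrank_near_id N.
have rkN : (\rank N)%:R <= (\rank A)%:R :> complex R.
  rewrite ler_nat; apply: leq_trans (mxrankM_maxl _ _) _.
  exact: mxrankM_maxr.
move=> /le_trans /(_ rkN); rewrite -lecR rmorphB /= !rmorph_nat.
apply: le_trans; rewrite lerB //.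
pose K := real_complex R (q%:R * t%:R / (2 * (k%:R - e))).
have K0 : 0 <= K by rewrite ler0c divr_ge0 // mulr_ge0 // ltW.
(* The diagonal of [N - 1] vanishes, so [K] bounds all [n^2] entries. *)
have E_le j l : `|(N - 1%:M) j l| ^+ 2 <= K ^+ 2.
  have -> : (N - 1%:M) j l = N j l - (j == l)%:R.
    by rewrite [LHS]mxE [(- 1%:M : 'M_n) j l]mxE [1%:M j l]mxE.
  have [->|jl] := eqVneq j l.
    by rewrite Njj subrr normr0 expr0n exprn_ge0.
  by rewrite subr0 lerXn2r ?nnegrE // Njl.
apply: le_trans (ler_sum _ (fun j _ => ler_sum _ (fun l _ => E_le j l))) _.
rewrite !sumr_const !card_ord.
rewrite -[K ^+ 2 *+ n *+ n]mulr_natl -[K ^+ 2 *+ n]mulr_natl.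
rewrite /K -!(rmorph_nat (real_complex R)) -rmorphXn -!rmorphM lecR.
by rewrite le_eqVlt !invfM; apply/orP; left; apply/eqP; ring.
Qed.

Theorem theorem3p2 (R : realType) (q k t m n : nat) (A : 'M[complex R]_(m, n))
    (hk : (1 <= k)%N) (hA : design_matrix q k t A) :
  n%:R - ((q%:R * t%:R * n%:R) / (2%:R * k%:R)) ^+ 2 <= (\rank A)%:R :> R.
Proof.
have k0 : 0 < k%:R :> R by rewrite ltr0n.
set b : R := q%:R * t%:R * n%:R.
have rn : 0 <= n%:R - (\rank A)%:R :> R.
  by rewrite subr_ge0 ler_nat rank_leq_col.
suff h : (n%:R - (\rank A)%:R) * k%:R ^+ 2 <= b ^+ 2 / 4.
  rewrite lerBlDl -lerBlDr expr_div_n ler_pdivlMr ?exprn_gt0 ?mulr_gt0 //.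
  by move: h; nra.
apply/ler_addgt0Pr => d d0.
(* For [y = n - rank A], replacing [(k - e)^2] by [k^2] costs at most [2 y k e <= c e <= d]; using
   [n + 1] keeps [c] positive when [n = 0]. *)
pose c : R := 2 * (n%:R + 1) * k%:R.
have c0 : 0 < c by rewrite !mulr_gt0 // ltr_wpDl.
pose e := Num.min (d / c) (k%:R / 2).
have e0 : 0 < e by rewrite lt_min !divr_gt0.
have ek : e < k%:R by rewrite gt_min; apply/orP; right; lra.
have ec : e * c <= d by rewrite -ler_pdivlMr // ge_min lexx.
have := design_rank_approx hA e0 ek; rewrite -/b.
have ke0 : 0 < k%:R - e by lra.
rewrite lerBlDl -lerBlDr expr_div_n ler_pdivlMr ?exprn_gt0 ?mulr_gt0 //.
have yn : n%:R - (\rank A)%:R <= n%:R + 1 :> R.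
  have : 0 <= (\rank A)%:R :> R by [].
  lra.
move: (n%:R - _) rn yn => y y0 yn hy.
have : e * k%:R * (2 * y) <= e * k%:R * (2 * (n%:R + 1)).
  by rewrite ler_pM2l ?mulr_gt0 // ler_pM2l.
have : 0 <= y * e ^+ 2 by rewrite mulr_ge0 ?sqr_ge0.
move: ec hy; rewrite /c; lra.
Qed.
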